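(* Let $p,q,n$ be positive integers, let $\mu\in\mathbb{R}^{pq}$, let $\Gamma\in\mathcal{M}_{p,p}(\mathbb{R})$ be a diagonal matrix with strictly positive diagonal entries, and let $\Psi\in\mathcal{M}_{q,q}(\mathbb{R})$ be symmetric positive definite ($\mu,\Gamma,\Psi$ unknown). Let $X_1,\ldots,X_n$ be independent random matrices in $\mathcal{M}_{p,q}(\mathbb{R})$ with $\mathrm{vec}(X_k)\sim\mathcal{N}(\mu,\Psi\otimes\Gamma)$ for $k=1,\ldots,n$. If $n>q$ and $p=2$, then the maximum likelihood estimator of $\Psi\otimes\Gamma$ (in the model in which $\Gamma$ is constrained to be diagonal and $\Psi$ is only constrained to be positive definite) is unique with probability $1$.
   Context: $\mathcal{M}_{p,q}(\mathbb{R})$ is the set of real $p\times q$ matrices, $\mathrm{vec}$ stacks the columns of a matrix into one vector, and $\otimes$ is the Kronecker product. The likelihood function, for $M\in\mathcal{M}_{p,q}(\mathbb{R})$ (with $\mathrm{vec}(M)$ the mean vector) and positive definite $\Gamma\in\mathcal{M}_{p,p}(\mathbb{R})$, $\Psi\in\mathcal{M}_{q,q}(\mathbb{R})$, is $$L(M,\Gamma,\Psi)=(2\pi)^{-\frac12 pqn}|\Gamma|^{-\frac12 qn}|\Psi|^{-\frac12 pn}\exp\Big(-\tfrac12\,\mathrm{trace}\Big(\Psi^{-1}\sum_{k=1}^n (X_k-M)^T\Gamma^{-1}(X_k-M)\Big)\Big),$$ where $|A|$ is the determinant of $A$. It depends on $(\Gamma,\Psi)$ only through $\Psi\otimes\Gamma$.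 In the model with $\Gamma$ diagonal, a maximum likelihood estimator of $\Psi\otimes\Gamma$ is a matrix $\hat\Psi\otimes\hat\Gamma$, with $\hat\Gamma$ diagonal with strictly positive diagonal entries and $\hat\Psi$ symmetric positive definite, such that $L$ attains its maximum over all $M\in\mathcal{M}_{p,q}(\mathbb{R})$, all diagonal $\Gamma$ with strictly positive diagonal entries and all symmetric positive definite $\Psi$ at $(\hat M,\hat\Gamma,\hat\Psi)$, where $\hat M=\frac1n\sum_{k=1}^n X_k$. It is unique if there is exactly one such matrix $\hat\Psi\otimes\hat\Gamma$ (uniqueness concerns the Kronecker product, not the two factors separately). *)

(* Defs.v *)
From HB Require Import structures.
From mathcomp Require Import all_boot all_order all_algebra.
From mathcomp Require Import all_classical all_reals all_analysis.
From mathcomp.real_closed Require Import mxtens.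

Set Implicit Arguments.
Unset Strict Implicit.
Unset Printing Implicit Defensive.

Import Order.TTheory GRing.Theory Num.Theory.
Import numFieldNormedType.Exports.

Local Open Scope classical_set_scope.
Local Open Scope ring_scope.

Section Matrices.
Context {R : realType}.

Definition is_posdef (n : nat) (A : 'M[R]_n) : Prop :=
  A^T = A /\ forall v : 'cV[R]_n, v != 0 -> 0 < (v^T *m A *m v) 0 0.

Definition is_posdiag (n : nat) (A : 'M[R]_n) : Prop :=
  is_diag_mx A /\ forall i, 0 < A i i.

(* Column stacking: entry (i, j) of X goes to position j * p + i, which is
   also the indexing of the rows and columns of Psi *t Gamma (Kronecker
   product) for Psi of size q and Gamma of size p. MathComp's mxvec stacks
   rows instead. *)
Definition vec (p q : nat) (X : 'M[R]_(p, q)) : 'cV[R]_(q * p) :=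
  \col_k X (mxtens_unindex k).2 (mxtens_unindex k).1.

End Matrices.

Section RandomMatrices.
Context {R : realType} {d : measure_display} {T : measurableType d}.
Variable P : probability T R.

Definition borel_matrix (p q : nat) : set (set 'M[R]_(p, q)) :=
  <<s [set U : set 'M[R]_(p, q) | open U] >>.

Definition is_random_matrix (p q : nat) (X : T -> 'M[R]_(p, q)) : Prop :=
  forall B, borel_matrix B -> measurable (X @^-1` B).

Definition independent_matrices (p q n : nat)
    (X : 'I_n -> T -> 'M[R]_(p, q)) : Prop :=
  forall (J : {set 'I_n}) (B : 'I_n -> set 'M[R]_(p, q)),
    (forall k, borel_matrix (B k)) ->
    P [set w | forall k, k \in J -> B k (X k w)] =
    (\prod_(k in J) P (X k @^-1` B k))%E.

(* Univariate normal law with mean m and variance v. The library's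
   normal_prob takes the standard deviation and is not a point mass when
   that is 0. *)
Definition normal_law (m v : R) (B : set R) : \bar R :=
  if v == 0 then \d_m B else normal_prob m (Num.sqrt v) B.

(* Y ~ N(m, S): every linear functional a^T Y has the univariate law
   N(a^T m, a^T S a). *)
Definition multivariate_normal (N : nat) (Y : T -> 'cV[R]_N)
    (m : 'cV[R]_N) (S : 'M[R]_N) : Prop :=
  is_random_matrix Y /\
  forall (a : 'cV[R]_N) (B : set R), measurable B ->
    P [set w | B ((a^T *m Y w) 0 0)] =
    normal_law ((a^T *m m) 0 0) ((a^T *m S *m a) 0 0) B.

End RandomMatrices.

Section Likelihood.
Context {R : realType}.
Variables (p q n : nat) (X : 'I_n -> 'M[R]_(p, q)).

Definition likelihood (M : 'M[R]_(p, q)) (Gamma : 'M[R]_p) (Psi : 'M[R]_q) : R :=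
  (2 * pi) `^ (- ((p * q * n)%:R / 2)) *
  (\det Gamma) `^ (- ((q * n)%:R / 2)) *
  (\det Psi) `^ (- ((p * n)%:R / 2)) *
  expR (- (\tr (invmx Psi *m
                \sum_(k < n) ((X k - M)^T *m invmx Gamma *m (X k - M))) / 2)).

Definition sample_mean : 'M[R]_(p, q) := n%:R^-1 *: \sum_(k < n) X k.

Definition is_mle_diag (K : 'M[R]_(q * p)) : Prop :=
  exists (Gammah : 'M[R]_p) (Psih : 'M[R]_q),
    [/\ is_posdiag Gammah, is_posdef Psih, K = Psih *t Gammah &
        forall (M : 'M[R]_(p, q)) (Gamma : 'M[R]_p) (Psi : 'M[R]_q),
          is_posdiag Gamma -> is_posdef Psi ->
          likelihood M Gamma Psi <= likelihood sample_mean Gammah Psih].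

End Likelihood.

(* Main.v *)
(* Profiling out the mean leaves the minimization, over positive g = diag(Gamma^-1)
   and positive definite Psi, of
     tr(Psi^-1 (sum_j g_j S_j)) + p n ln det Psi - q n sum_j ln g_j,
   where S_j is the scatter matrix of the j-th rows of the samples.  Two
   minimizers are compared with the midpoint of the geodesic joining them,
   after simultaneous diagonalization: AM-GM forces (g', Psi') = (c g, c Psi),
   which leaves Psi (x) Gamma unchanged.  For existence, the optimal Psi at
   fixed g is a multiple of sum_j g_j S_j; for p = 2 what remains depends on
   t = g_1 / g_0 only, and if l_i are the eigenvalues of S_1 relative to S_0,
   the intermediate value theorem gives t with sum_i t l_i / (1 + t l_i) = q / 2,
   which is a minimum by concavity of ln.

   All this needs S_0 and S_1 positive definite, which holds as soon as the
   differences X_1 - X_0, ..., X_q - X_0 of the corresponding rows are linearly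
   independent.  A Gaussian vector with positive definite covariance charges no
   hyperplane, hence, by Fubini and independence, no random hyperplane
   determined by the previous samples; an induction on the number of samples
   shows that the determinant of the differences is almost surely nonzero. *)
Require Import Defs.
From HB Require Import structures.
From mathcomp Require Import all_boot all_order all_algebra.
From mathcomp Require Import all_classical all_reals all_analysis measurable_realfun.
From mathcomp.real_closed Require Import mxtens complex.
From mathcomp Require Import ring lra.

Set Implicit Arguments.
Unset Strict Implicit.
Unset Printing Implicit Defensive.

Import Order.TTheory GRing.Theory Num.Theory.
Import numFieldNormedType.Exports.

Local Open Scope classical_set_scope.
Local Open Scope ring_scope.

(** * Simultaneous diagonalization *)

Section PositiveDefinite.
Context {R : realType}.

Lemma posdef_row n (A : 'M[R]_n) (v : 'rV[R]_n) :
  is_posdef A -> v != 0 -> 0 < (v *m A *m v^T) 0 0.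
Proof.
move=> [_ Apos] v0; have := Apos v^T; rewrite trmxK; apply.
by rewrite -trmx0 (inj_eq trmx_inj).
Qed.

Lemma row_posdef n (A : 'M[R]_n) : A^T = A ->
  (forall v : 'rV[R]_n, v != 0 -> 0 < (v *m A *m v^T) 0 0) -> is_posdef A.
Proof.
move=> symA posA; split=> // v v0; have := posA v^T; rewrite trmxK; apply.
by rewrite -trmx0 (inj_eq trmx_inj).
Qed.

Lemma posdef_unitmx n (A : 'M[R]_n) : is_posdef A -> A \in unitmx.
Proof.
move=> pA; rewrite unitmxE unitfE; apply/det0P => -[v v0 vA].
by have := posdef_row pA v0; rewrite vA mul0mx mxE ltxx.
Qed.

Lemma posdef_congr m n (A : 'M[R]_n) (Q : 'M[R]_(m, n)) :
  is_posdef A -> row_free Q -> is_posdef (Q *m A *m Q^T).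
Proof.
move=> pA /row_freeP[Q' QQ']; apply: row_posdef => [|v v0].
  by rewrite !trmx_mul trmxK pA.1 mulmxA.
have vQ0 : v *m Q != 0.
  apply: contra_neq v0 => vQ0.
  by rewrite -[v]mulmx1 -QQ' mulmxA vQ0 mul0mx.
by have := posdef_row pA vQ0; rewrite trmx_mul !mulmxA.
Qed.

Lemma Re_mulmx_real m n (w : 'M[R[i]]_(m, n)) p (B : 'M[R]_(n, p)) :
  map_mx (@complex.Re R) (w *m map_mx (real_complex R) B) =
  map_mx (@complex.Re R) w *m B.
Proof.
apply/matrixP => i j; rewrite !mxE (big_morph (@complex.Re R) (id1 := 0) (op1 := +%R)) //.
  by apply: eq_bigr => k _; rewrite !mxE; case: (w i k) => a b /=; rewrite mulr0 subr0.
by move=> [a b] [a' b'].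
Qed.

Lemma Im_mulmx_real m n (w : 'M[R[i]]_(m, n)) p (B : 'M[R]_(n, p)) :
  map_mx (@complex.Im R) (w *m map_mx (real_complex R) B) =
  map_mx (@complex.Im R) w *m B.
Proof.
apply/matrixP => i j; rewrite !mxE (big_morph (@complex.Im R) (id1 := 0) (op1 := +%R)) //.
  by apply: eq_bigr => k _; rewrite !mxE; case: (w i k) => a b /=; rewrite mulr0 add0r.
by move=> [a b] [a' b'].
Qed.

Lemma mulmx_sym_tr n (B : 'M[R]_n) (x y : 'rV[R]_n) : B^T = B ->
  (x *m B *m y^T) 0 0 = (y *m B *m x^T) 0 0.
Proof.
move=> symB; rewrite -[in LHS](trmxK (x *m B *m y^T)) mxE.
by rewrite !trmx_mul trmxK symB mulmxA.
Qed.

(* A complex eigenvector x + iy of the pencil with eigenvalue a + ib satisfies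
   b (x A x^T + y A y^T) = 0, so the eigenvalue is real and both x and y are
   real eigenvectors. *)
Lemma pencil_eigenvector n (A B : 'M[R]_n) : (0 < n)%N ->
  is_posdef A -> B^T = B ->
  exists (a : R) (v : 'rV[R]_n), v != 0 /\ v *m B = a *: (v *m A).
Proof.
move=> n0 pA symB; pose f := real_complex R : {rmorphism R -> R[i]}.
have [l /eigenvalueP[z zl z0]] :=
  eigenvalue_closed (map_mx f (B *m invmx A)) n0.
have Au := posdef_unitmx pA.
have zB : z *m map_mx f B = l *: (z *m map_mx f A).
  rewrite -[in LHS](mulmxKV Au B) map_mxM mulmxA zl -scalemxAl //.
pose x := map_mx (@complex.Re R) z; pose y := map_mx (@complex.Im R) z.
pose a := complex.Re l; pose b := complex.Im l.
have xB : x *m B = a *: (x *m A) - b *: (y *m A).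
  rewrite /x /y -!Re_mulmx_real -!Im_mulmx_real zB; apply/rowP => j.
  by rewrite !mxE /a /b; case: (l) => ? ?; case: (\sum_(_ < _) _).
have yB : y *m B = a *: (y *m A) + b *: (x *m A).
  rewrite /x /y -!Re_mulmx_real -!Im_mulmx_real zB; apply/rowP => j.
  by rewrite !mxE /a /b; case: (l) => ? ?; case: (\sum_(_ < _) _).
have lin (M N : 'M[R]_1) (c e : R) :
    (c *: M + e *: N) 0 0 = c * M 0 0 + e * N 0 0 by rewrite !mxE.
have b0 : b * ((x *m A *m x^T) 0 0 + (y *m A *m y^T) 0 0) = 0.
  have := mulmx_sym_tr x y symB.
  rewrite xB yB -scaleNr !mulmxDl -!scalemxAl !lin (mulmx_sym_tr x y pA.1).
  lra.
have pos (u : 'rV[R]_n) : 0 <= (u *m A *m u^T) 0 0.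
  by have [->|/(posdef_row pA)/ltW//] := eqVneq u 0; rewrite !mul0mx mxE.
have xy0 : (x != 0) || (y != 0).
  rewrite -negb_and; apply: contra z0 => /andP[/eqP x0 /eqP y0].
  apply/eqP/rowP => j; move/rowP/(_ j): x0; move/rowP/(_ j): y0.
  by rewrite !mxE; case: (z _ _) => u v /= -> ->.
have {}b0 : b = 0.
  move/eqP: b0; rewrite mulf_eq0 => /orP[/eqP//|]; rewrite paddr_eq0 //.
  case/andP=> /eqP xx /eqP yy; case/orP: xy0 => /(posdef_row pA).
    by rewrite xx ltxx.
  by rewrite yy ltxx.
rewrite b0 scale0r subr0 in xB; rewrite b0 scale0r addr0 in yB.
by exists a; case/orP: xy0 => u0; [exists x|exists y].
Qed.

(** Induction on the dimension. An eigenvector [v] of the pencil satisfies v B = a v A, so its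
    A-orthogonal complement is also B-orthogonal to it, and the induction hypothesis applies to both
    forms restricted to that complement. *)
Lemma simultaneous_diagonalization n (A B : 'M[R]_n) :
  is_posdef A -> B^T = B ->
  exists (P : 'M[R]_n) (d : 'rV[R]_n),
    P *m A *m P^T = 1%:M /\ P *m B *m P^T = diag_mx d.
Proof.
elim: n A B => [|n IHn] A B pA symB.
  by exists 0, 0; split; apply/matrixP => -[].
have [a [v0 [v0_neq0 v0B]]] := pencil_eigenvector (ltn0Sn n) pA symB.
have v0A := posdef_row pA v0_neq0.
pose v := (Num.sqrt ((v0 *m A *m v0^T) 0 0))^-1 *: v0.
have vA : v *m A *m v^T = 1%:M.
  rewrite [LHS]mx11_scalar /v linearZ -!scalemxAl -scalemxAr scalerA.
  set s := (v0 *m A *m v0^T) in v0A *.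
  congr (_%:M); rewrite mxE -invfM -expr2 sqr_sqrtr ?ltW // mulVf //.
  by rewrite gt_eqF.
have vB : v *m B = a *: (v *m A).
  by rewrite /v -!scalemxAl v0B !scalerA mulrC.
(* The rows of [Q] are a basis of the A-orthogonal complement of [v], of dimension [n] because A v^T
   is nonzero. *)
have [Q [Qfree QA]] : exists Q : 'M[R]_(n, n.+1),
    row_free Q /\ Q *m (A *m v^T) = 0.
  pose K := kermx (A *m v^T).
  have rK : \rank K = n.
    rewrite mxrank_ker; suff -> : \rank (A *m v^T) = 1%N by rewrite subn1.
    apply/eqP; rewrite eqn_leq rank_leq_col lt0n mxrank_eq0.
    apply: contra_eq_neq vA => AvT; rewrite -mulmxA AvT mulmx0 eq_sym.
    exact: matrix_nonzero1.
  have : exists Q : 'M[R]_(\rank K, n.+1), row_free Q /\ Q *m (A *m v^T) = 0.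
    exists (row_base K); split; first exact: row_base_free.
    by apply/sub_kermxP; rewrite eq_row_base.
  by rewrite rK.
have vAQ : v *m A *m Q^T = 0.
  apply: trmx_inj; rewrite !trmx_mul trmxK pA.1 trmx0 mulmxA -mulmxA //.
have symQB : (Q *m B *m Q^T)^T = Q *m B *m Q^T.
  by rewrite !trmx_mul trmxK symB mulmxA.
have [P [d [PA PB]]] := IHn _ _ (posdef_congr pA Qfree) symQB.
exists (col_mx v (P *m Q)), (row_mx (const_mx a : 'rV_1) d).
have orth (M : 'M[R]_n.+1) : M^T = M -> v *m M *m Q^T = 0 ->
    Q *m M *m v^T = 0.
  by move=> symM vMQ; apply: trmx_inj; rewrite !trmx_mul trmxK symM mulmxA vMQ trmx0.
have blk (M : 'M[R]_n.+1) : M^T = M -> v *m M *m Q^T = 0 ->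
    col_mx v (P *m Q) *m M *m (col_mx v (P *m Q))^T =
    block_mx (v *m M *m v^T) 0 0 (P *m (Q *m M *m Q^T) *m P^T).
  move=> symM vMQ.
  have QMv := orth _ symM vMQ.
  rewrite mul_col_mx (@tr_col_mx _ 1%N) mul_col_row trmx_mul.
  congr block_mx; rewrite ?mulmxA ?vMQ ?mul0mx //.
  by rewrite -!mulmxA in QMv *; rewrite QMv mulmx0.
split; rewrite blk ?pA.1 //.
- by rewrite vA PA -scalar_mx_block.
- by rewrite vB -scalemxAl vA PB (@diag_mx_row _ n 1%N) diag_const_mx scale_scalar_mx mulr1.
- by rewrite vB -scalemxAl vAQ scaler0.
Qed.
End PositiveDefinite.

(** * Uniqueness of the minimizer *)

Section KroneckerObjective.
Context {R : realType}.

Lemma diag_mx_posdef n (d : 'rV[R]_n) :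
  (forall i, 0 < d 0 i) -> is_posdef (diag_mx d).
Proof.
move=> d0; apply: row_posdef => [|v v0]; first exact: tr_diag_mx.
have -> : (v *m diag_mx d *m v^T) 0 0 = \sum_i d 0 i * v 0 i ^+ 2.
  rewrite mxE; apply: eq_bigr => i _.
  by rewrite mul_mx_diag !mxE mulrAC mulrC -expr2.
have [i vi] : exists i, v 0 i != 0.
  apply/existsP; rewrite -negb_forall; apply: contra v0 => /forallP v0.
  by apply/eqP/rowP => i; rewrite mxE; exact/eqP.
rewrite (bigD1 i) //= ltr_wpDr //.
  by apply: sumr_ge0 => j _; rewrite mulr_ge0 ?sqr_ge0 // ltW.
by rewrite mulr_gt0 // exprn_even_gt0.
Qed.

Lemma posdef_diag_gt0 n (A : 'M[R]_n) i : is_posdef A -> 0 < A i i.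
Proof.
move=> /(posdef_row (v := delta_mx 0 i)); rewrite -rowE.
have -> : (row i A *m (delta_mx 0 i : 'rV_n)^T) 0 0 = A i i.
  by rewrite trmx_delta -colE !mxE.
apply; apply/eqP => /rowP/(_ i)/eqP.
by rewrite !mxE !eqxx oner_eq0.
Qed.

Lemma congr_diag_unit n (P A : 'M[R]_n) : P *m A *m P^T = 1%:M -> P \in unitmx.
Proof. by move=> /mulmx1_unit[+ _]; rewrite unitmx_mul => /andP[]. Qed.

Lemma congr_diag_gt0 n (P B : 'M[R]_n) (d : 'rV[R]_n) i : P \in unitmx ->
  is_posdef B -> P *m B *m P^T = diag_mx d -> 0 < d 0 i.
Proof.
move=> Pu pB PB.
have := posdef_diag_gt0 i (posdef_congr pB (_ : row_free P)).
by rewrite row_free_unit => /(_ Pu); rewrite PB !mxE eqxx.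
Qed.

Lemma ln_prod (I : finType) (F : I -> R) :
  (forall i, 0 < F i) -> ln (\prod_i F i) = \sum_i ln (F i).
Proof.
move=> F0.
suff [] : 0 < \prod_i F i /\ ln (\prod_i F i) = \sum_i ln (F i) by [].
elim/big_rec2: _ => [|i y x _ [x0 <-]]; first by rewrite ln1.
by rewrite mulr_gt0 // lnM ?posrE.
Qed.

Lemma congr_diag n (P B : 'M[R]_n) (d : 'rV[R]_n) : P \in unitmx ->
  (forall i, 0 < d 0 i) -> P *m B *m P^T = diag_mx d ->
  invmx B = P^T *m diag_mx (map_mx GRing.inv d) *m P /\
  \det B = (\det P) ^- 2 * \prod_i d 0 i.
Proof.
move=> Pu d0 PB.
have PTu : P^T \in unitmx by rewrite unitmx_tr.
have BE : B = invmx P *m diag_mx d *m invmx P^T.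
  by rewrite -PB !mulmxA mulVmx // mul1mx mulmxK.
have dd : diag_mx (map_mx GRing.inv d) *m diag_mx d = 1%:M.
  rewrite mulmx_diag -diag_const_mx; congr diag_mx; apply/rowP => i.
  by rewrite !mxE mulVf // gt_eqF.
have CB : P^T *m diag_mx (map_mx GRing.inv d) *m P *m B = 1%:M.
  rewrite BE !mulmxA mulmxK // -(mulmxA P^T) dd mulmx1.
  by rewrite mulmxV.
split.
  have [_ Bu] := mulmx1_unit CB.
  by rewrite -[RHS](mulmxK Bu) CB mul1mx.
rewrite BE !det_mulmx det_diag det_inv mulrAC; congr (_ * _).
by rewrite det_inv det_tr -invfM expr2.
Qed.

Lemma trace_congr_diag n (P B S : 'M[R]_n) (d : 'rV[R]_n) : P \in unitmx ->
  (forall i, 0 < d 0 i) -> P *m B *m P^T = diag_mx d ->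
  \tr (invmx B *m S) = \sum_i (P *m S *m P^T) i i / d 0 i.
Proof.
move=> Pu d0 PB; have [-> _] := congr_diag Pu d0 PB.
rewrite -!mulmxA mxtrace_mulC -!mulmxA; apply: eq_bigr => i _.
by rewrite mul_diag_mx [LHS]mxE mulrC !mulmxA [map_mx _ _ _ _]mxE.
Qed.

(* As a function of the inverses [g] of the diagonal entries of Gamma and up to
   an additive constant, -2 log of the likelihood at the sample mean, where
   [S j] is the scatter matrix of the [j]-th rows. *)
Definition objective (p q n : nat) (S : 'I_p -> 'M[R]_q) (g : 'I_p -> R)
    (Psi : 'M[R]_q) : R :=
  \tr (invmx Psi *m \sum_j g j *: S j) + (p * n)%:R * ln (\det Psi) -
  (q * n)%:R * \sum_j ln (g j).

Lemma det_unit_sqr_gt0 n (P : 'M[R]_n) : P \in unitmx -> 0 < (\det P) ^- 2.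
Proof. by rewrite unitmxE unitfE invr_gt0 => Pu; rewrite exprn_even_gt0. Qed.

Lemma ln_det_congr n (P B : 'M[R]_n) (d : 'rV[R]_n) : P \in unitmx ->
  (forall i, 0 < d 0 i) -> P *m B *m P^T = diag_mx d ->
  ln (\det B) = ln ((\det P) ^- 2) + \sum_i ln (d 0 i).
Proof.
move=> Pu d0 PB; have [_ ->] := congr_diag Pu d0 PB.
by rewrite lnM ?ln_prod ?posrE ?det_unit_sqr_gt0 // prodr_gt0.
Qed.

(** In coordinates where [Psi] is diagonal the objective is explicit. A single [P] will serve for
    two minimizers and for their midpoint. *)
Lemma objective_congr p q n (S : 'I_p -> 'M[R]_q) g (P Psi : 'M[R]_q)
    (d : 'rV[R]_q) :
  P \in unitmx -> (forall i, 0 < d 0 i) -> P *m Psi *m P^T = diag_mx d ->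
  objective n S g Psi =
  \sum_i \sum_j g j * (P *m S j *m P^T) i i / d 0 i +
  (p * n)%:R * (ln ((\det P) ^- 2) + \sum_i ln (d 0 i)) -
  (q * n)%:R * \sum_j ln (g j).
Proof.
move=> Pu d0 PPsi; congr (_ + _ * _ - _); last exact: ln_det_congr.
rewrite (trace_congr_diag _ Pu d0 PPsi); apply: eq_bigr => i _.
rewrite mulmx_sumr mulmx_suml summxE mulr_suml; apply: eq_bigr => j _.
by rewrite -scalemxAr -scalemxAl [in LHS]mxE.
Qed.

Definition minimizes p q n (S : 'I_p -> 'M[R]_q) (g : 'I_p -> R)
    (Psi : 'M[R]_q) : Prop :=
  [/\ (forall j, 0 < g j), is_posdef Psi &
      forall g' Psi', (forall j, 0 < g' j) -> is_posdef Psi' ->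
        objective n S g Psi <= objective n S g' Psi'].

(* The objective is convex along the geodesic joining (g, Psi) to (g', Psi');
   comparing the end points with the midpoint leaves the sum of squares. *)
Lemma minimizer_unique p q n (S : 'I_p -> 'M[R]_q) g Psi g' Psi' :
  (0 < p)%N -> (0 < q)%N -> (forall j, is_posdef (S j)) ->
  minimizes n S g Psi -> minimizes n S g' Psi' ->
  exists c, [/\ 0 < c, (forall j, g' j = c * g j) & Psi' = c *: Psi].
Proof.
move=> p0 q0 pS [g0 pPsi minPsi] [g'0 pPsi' minPsi'].
have [P [d [PPsi PPsi']]] := simultaneous_diagonalization pPsi pPsi'.1.
have Pu := congr_diag_unit PPsi.
have d0 i := congr_diag_gt0 i Pu pPsi' PPsi'.
rewrite -diag_const_mx in PPsi.
pose e : 'rV[R]_q := map_mx Num.sqrt d.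
have e0 i : 0 < e 0 i by rewrite mxE sqrtr_gt0.
pose h j := Num.sqrt (g j); pose h' j := Num.sqrt (g' j).
have h0 j : 0 < h j by rewrite sqrtr_gt0.
have h'0 j : 0 < h' j by rewrite sqrtr_gt0.
have dE i : d 0 i = e 0 i ^+ 2 by rewrite mxE sqr_sqrtr ?ltW.
have gE j : g j = h j ^+ 2 by rewrite sqr_sqrtr ?ltW.
have g'E j : g' j = h' j ^+ 2 by rewrite sqr_sqrtr ?ltW.
(* [P] sends the end points to the identity and diag d, so the geodesic midpoint is sent to diag
   (sqrt d); [gm] is the entrywise geometric mean of [g] and [g']. *)
pose Psim := invmx P *m diag_mx e *m (invmx P)^T.
have pPsim : is_posdef Psim.
  by apply: posdef_congr; [exact: diag_mx_posdef|rewrite row_free_unit unitmx_inv].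
have PPsim : P *m Psim *m P^T = diag_mx e.
  by rewrite /Psim !mulmxA mulmxV // mul1mx -mulmxA -trmx_mul mulmxV // trmx1 mulmx1.
pose gm j := h j * h' j.
have gm0 j : 0 < gm j by rewrite mulr_gt0.
have one0 i : 0 < (const_mx 1 : 'rV[R]_q) 0 i by rewrite mxE.
pose s i j := (P *m S j *m P^T) i i.
have s0 i j : 0 < s i j.
  by apply/posdef_diag_gt0/posdef_congr; rewrite ?row_free_unit.
(* Add the two minimality inequalities at the midpoint. Each logarithm there is the average of those
   at the end points, so all logarithms cancel and only traces remain. *)
have sumsq : \sum_i \sum_j s i j * (h j - h' j / e 0 i) ^+ 2 <= 0.
  have := minPsi _ _ gm0 pPsim; have := minPsi' _ _ gm0 pPsim.
  rewrite (objective_congr _ _ _ Pu one0 PPsi) (objective_congr _ _ _ Pu d0 PPsi').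
  rewrite (objective_congr _ _ _ Pu e0 PPsim).
  have -> : \sum_i ln (d 0 i) = 2 * \sum_i ln (e 0 i).
    by rewrite mulr_sumr; apply: eq_bigr => i _; rewrite dE lnXn // mulr_natl.
  have -> : \sum_i ln ((const_mx 1 : 'rV[R]_q) 0 i) = 0.
    by apply: big1 => i _; rewrite mxE ln1.
  have -> : \sum_j ln (gm j) = \sum_j ln (h j) + \sum_j ln (h' j).
    by rewrite -big_split; apply: eq_bigr => j _; rewrite lnM ?posrE.
  have -> : \sum_j ln (g j) = 2 * \sum_j ln (h j).
    by rewrite mulr_sumr; apply: eq_bigr => i _; rewrite gE lnXn // mulr_natl.
  have -> : \sum_j ln (g' j) = 2 * \sum_j ln (h' j).
    by rewrite mulr_sumr; apply: eq_bigr => i _; rewrite g'E lnXn // mulr_natl.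
  have -> : \sum_i \sum_j s i j * (h j - h' j / e 0 i) ^+ 2 =
    \sum_i \sum_j g j * (P *m S j *m P^T) i i / (const_mx 1 : 'rV[R]_q) 0 i +
    \sum_i \sum_j g' j * (P *m S j *m P^T) i i / d 0 i -
    2 * \sum_i \sum_j gm j * (P *m S j *m P^T) i i / e 0 i.
    rewrite mulr_sumr -big_split -sumrB; apply: eq_bigr => i _ /=.
    rewrite mulr_sumr -big_split -sumrB; apply: eq_bigr => j _ /=.
    rewrite -/(s i j) (gE j) (g'E j) dE /gm [const_mx 1 0 i]mxE.
    by field; rewrite gt_eqF.
  lra.
have eq_h i j : e 0 i * h j = h' j.
  have : s i j * (h j - h' j / e 0 i) ^+ 2 <= 0.
    apply: le_trans sumsq; rewrite (bigD1 i) //= (bigD1 j) //= -addrA lerDl.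
    by rewrite addr_ge0 // sumr_ge0 // => k _; rewrite ?sumr_ge0 // => *;
      rewrite mulr_ge0 ?sqr_ge0 // ltW.
  rewrite pmulr_rle0 // le_eqVlt ltNge sqr_ge0 orbF sqrf_eq0 subr_eq0 => /eqP ->.
  by rewrite mulrC divfK // gt_eqF.
pose i0 := Ordinal q0; pose j0 := Ordinal p0.
(* The product [e 0 i * h j] does not depend on [i], so [e] is constant; its square is the scaling
   factor [c]. *)
have e_const i : e 0 i = e 0 i0.
  by apply: (mulIf (lt0r_neq0 (h0 j0))); rewrite !eq_h.
exists (e 0 i0 ^+ 2); split=> [|j|]; first by rewrite exprn_gt0.
  by rewrite gE g'E -(eq_h i0) exprMn.
have PTu : P^T \in unitmx by rewrite unitmx_tr.
apply: (can_inj (mulKmx Pu)); apply: (can_inj (mulmxK PTu)).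
rewrite PPsi' -scalemxAr -scalemxAl PPsi.
by apply/matrixP => i j; rewrite -(e_const i) -dE !mxE mulrnAr mulr1.
Qed.

End KroneckerObjective.

(** * Existence of the minimizer *)

Section Existence.
Context {R : realType}.

Lemma ln_le_subr1 (x : R) : 0 < x -> ln x <= x - 1.
Proof.
by move=> x0; rewrite -[X in ln X](subrK 1) addrC le_ln1Dx // ltrBrDr addrC subrr.
Qed.

Lemma sum_posdef p q (S : 'I_p -> 'M[R]_q) (g : 'I_p -> R) : (0 < p)%N ->
  (forall j, 0 < g j) -> (forall j, is_posdef (S j)) ->
  is_posdef (\sum_j g j *: S j).
Proof.
move=> p0 g0 pS; apply: row_posdef => [|v v0].
  rewrite linear_sum; apply: eq_bigr => j _.
  by rewrite linearZ /= (pS j).1.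
rewrite mulmx_sumr mulmx_suml summxE (bigD1 (Ordinal p0)) //= ltr_wpDr //.
  by apply: sumr_ge0 => j _; rewrite -scalemxAr -scalemxAl mxE mulr_ge0 ?ltW //
    posdef_row.
by rewrite -scalemxAr -scalemxAl mxE mulr_gt0 // posdef_row.
Qed.

Lemma posdef_scale q (S : 'M[R]_q) (c : R) :
  0 < c -> is_posdef S -> is_posdef (c *: S).
Proof.
move=> c0 pS; apply: row_posdef => [|v v0]; first by rewrite linearZ /= pS.1.
by rewrite -scalemxAr -scalemxAl mxE mulr_gt0 // posdef_row.
Qed.

(** If d_i are the eigenvalues of [Psi] relative to [T], the quantity to bound is N ln det T plus
    the sum of 1/d_i + N ln d_i. The inequality ln x <= x - 1 at x = 1/(N d_i) bounds each term
    below by N (1 - ln N), with equality at d_i = 1/N, that is, at [N^-1 *: T]. *)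
Lemma trace_ln_det_min q (T Psi : 'M[R]_q) (N : R) : 0 < N ->
  is_posdef T -> is_posdef Psi ->
  N * ln (\det T) + N * (1 - ln N) * q%:R <= \tr (invmx Psi *m T) + N * ln (\det Psi)
  /\ \tr (invmx (N^-1 *: T) *m T) + N * ln (\det (N^-1 *: T)) =
     N * ln (\det T) + N * (1 - ln N) * q%:R.
Proof.
move=> N0 pT pPsi.
have [P [d [PT PPsi]]] := simultaneous_diagonalization pT pPsi.1.
have Pu := congr_diag_unit PT.
have d0 i := congr_diag_gt0 i Pu pPsi PPsi.
have lnT : ln (\det T) = ln ((\det P) ^- 2).
  rewrite -diag_const_mx in PT.
  rewrite (ln_det_congr Pu _ PT) => [|i]; last by rewrite mxE.
  by rewrite big1 ?addr0 // => i _; rewrite mxE ln1.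
split.
  rewrite (trace_congr_diag _ Pu d0 PPsi) PT (ln_det_congr Pu d0 PPsi) lnT.
  rewrite [X in _ <= _ + X]mulrDr [leRHS]addrCA lerD2l mulr_sumr -big_split /=.
  rewrite mulr_natr -[X in _ *+ X]card_ord -sumr_const; apply: ler_sum => i _.
  rewrite mxE eqxx mulr1n.
  have := @ln_le_subr1 ((N * d 0 i)^-1); rewrite invr_gt0 mulr_gt0 // => /(_ isT).
  rewrite lnV ?posrE ?mulr_gt0 // lnM ?posrE // => le_ln.
  have {le_ln} := ler_wpM2l (ltW N0) le_ln.
  rewrite mulrBr invfM mulrA mulfV ?gt_eqF //.
  by rewrite div1r; lra.
have PNT : P *m (N^-1 *: T) *m P^T = diag_mx (const_mx N^-1).
  by rewrite -scalemxAr -scalemxAl PT diag_const_mx scale_scalar_mx mulr1.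
have N'0 i : 0 < (const_mx N^-1 : 'rV[R]_q) 0 i by rewrite mxE invr_gt0.
rewrite (trace_congr_diag _ Pu N'0 PNT) PT (ln_det_congr Pu N'0 PNT) lnT.
under eq_bigr do rewrite !mxE eqxx mulr1n div1r invrK.
under [in X in _ + _ * (_ + X)]eq_bigr do rewrite mxE lnV ?posrE //.
by rewrite !sumr_const card_ord -(mulr_natr N) -(mulr_natr (- ln N)); ring.
Qed.

(* At the chosen t, the weights w i = t * l i / (1 + t * l i) have mean 1/2, and
   concavity of ln gives ln ((1 + s l i) / (1 + t l i)) >= w i * ln (s / t). *)
Lemma ratio_minimizer q (l : 'I_q -> R) : (0 < q)%N -> (forall i, 0 < l i) ->
  exists t, 0 < t /\ forall a b, 0 < a -> 0 < b ->
    \sum_i (2 * ln (1 + t * l i) - ln t) <=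
    \sum_i (2 * ln (a + b * l i) - ln a - ln b).
Proof.
move=> q0 l0; pose i0 := Ordinal q0.
pose f t : R := \sum_i t * l i / (1 + t * l i).
have den0 t i : 0 < t -> 0 < 1 + t * l i.
  by move=> t0; rewrite ltr_wpDr // ltW // mulr_gt0.
have suml0 : 0 < \sum_i l i.
  rewrite (bigD1 i0) //= ltr_wpDr // sumr_ge0 // => i _; exact: ltW.
have sumV0 : 0 < \sum_i (l i)^-1.
  rewrite (bigD1 i0) //= ltr_wpDr ?invr_gt0 // sumr_ge0 // => i _.
  by rewrite ltW // invr_gt0.
have lsum i : l i <= \sum_i l i.
  rewrite (bigD1 i) //= lerDl sumr_ge0 // => j _; exact: ltW.
have Vsum i : (l i)^-1 <= \sum_i (l i)^-1.
  by rewrite (bigD1 i) //= lerDl sumr_ge0 // => j _; rewrite ltW // invr_gt0.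
(* These end points bracket the value q/2 of [f]: every term is at most 1/2 at [u], where u l_i <=
   1, and at least 1/2 at [v], where v l_i >= 1. *)
pose u := (\sum_i l i)^-1; pose v := \sum_i (l i)^-1.
have u0 : 0 < u by rewrite invr_gt0.
have ul i : u * l i <= 1 by rewrite ler_pdivrMl // mulr1.
have vl i : 1 <= v * l i by rewrite -ler_pdivrMr // div1r.
have uv : u <= v.
  by rewrite -(ler_pM2r (l0 i0)) (le_trans (ul i0)).
have half : \sum_(i < q) (2^-1 : R) = q%:R / 2.
  by rewrite sumr_const card_ord mulr_natl.
have fu : f u <= q%:R / 2.
  rewrite -half; apply: ler_sum => i _; rewrite ler_pdivrMr ?den0 //.
  by have := ul i; lra.
have fv : q%:R / 2 <= f v.
  rewrite -half; apply: ler_sum => i _; rewrite ler_pdivlMr ?den0 //.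
  by have := vl i; lra.
have [t /[!in_itv]/= /andP[ut _] ft] : exists2 t, t \in `[u, v] & f t = q%:R / 2.
  apply: IVT => //; last first.
    by rewrite minEle maxEle (le_trans fu fv) fu fv.
  apply: continuous_in_subspaceT => t /[!inE]/= /[!in_itv]/= /andP[ut _].
  have t0 : 0 < t by exact: lt_le_trans ut.
  apply: (@cvg_big _ _ +%R) => [|i _]; first exact: add_continuous.
  apply: cvgM; first by apply: cvgMl.
  apply: cvgV; first by rewrite gt_eqF // den0.
  by apply: cvgD; [exact: cvg_cst|apply: cvgMl].
have t0 : 0 < t by exact: lt_le_trans ut.
exists t; split=> // a b a0 b0.
pose r := b / a / t; have r0 : 0 < r by rewrite !divr_gt0.
pose w i := t * l i / (1 + t * l i).
have w0 i : 0 <= w i by rewrite divr_ge0 // ltW ?den0 // mulr_gt0.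
have w1 i : w i <= 1 by rewrite ler_pdivrMr ?den0 // mul1r lerDr.
have conc i : ln (1 + t * l i) + w i * ln r <= ln (a + b * l i) - ln a.
  (* With s = b/a and r = s/t, the combination of r and 1 with weights w_i and 1 - w_i is exactly (1
     + s l_i)/(1 + t l_i). *)
  have := @concave_ln R (@Itv01 R (w i) (w0 i) (w1 i)) r 1 r0 ltr01.
  rewrite !convRE /= ln1 mulr0 addr0 mulr1.
  have -> : w i * r + (1 - w i) = (a + b * l i) / (a * (1 + t * l i)).
    rewrite /w /r; field.
    by rewrite !gt_eqF // den0.
  have ab0 : 0 < a + b * l i by rewrite addr_gt0 // mulr_gt0.
  rewrite ln_div ?posrE ?mulr_gt0 ?den0 // lnM ?posrE ?den0 //.
  lra.
have lnr : ln r = ln b - ln a - ln t by rewrite /r !ln_div ?posrE ?divr_gt0.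
have sumw : \sum_i w i * ln r = q%:R / 2 * ln r by rewrite -mulr_suml -ft.
rewrite -subr_ge0 -sumrB.
(* The first sum is nonnegative by [conc]; the second vanishes because the weights add up to q/2. *)
have -> : \sum_i (2 * ln (a + b * l i) - ln a - ln b - (2 * ln (1 + t * l i) - ln t)) =
    \sum_i 2 * (ln (a + b * l i) - ln a - (ln (1 + t * l i) + w i * ln r)) +
    \sum_i (2 * (w i * ln r) - ln r).
  by rewrite -big_split; apply: eq_bigr => i _ /=; rewrite lnr; ring.
rewrite sumrB -!mulr_sumr sumw sumr_const card_ord -(mulr_natl (ln r)).
have -> : 2 * (q%:R / 2 * ln r) = q%:R * ln r by field.
by rewrite subrr addr0 mulr_ge0 // sumr_ge0 // => i _; rewrite subr_ge0.
Qed.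

Lemma minimizer_exists q n (S : 'I_2 -> 'M[R]_q) : (0 < q)%N -> (0 < n)%N ->
  (forall j, is_posdef (S j)) -> exists g Psi, minimizes n S g Psi.
Proof.
move=> q0 n0 pS.
have [P [l [PS0 PS1]]] := simultaneous_diagonalization (pS 0) (pS 1).1.
have Pu := congr_diag_unit PS0.
have l0 i := congr_diag_gt0 i Pu (pS 1) PS1.
have [t [t0 tmin]] := ratio_minimizer q0 l0.
have lnT (g : 'I_2 -> R) : (forall j, 0 < g j) ->
    ln (\det (\sum_j g j *: S j)) =
    ln ((\det P) ^- 2) + \sum_i ln (g 0 + g 1 * l 0 i).
  move=> g0; pose d : 'rV[R]_q := \row_i (g 0 + g 1 * l 0 i).
  have d0 i : 0 < d 0 i by rewrite mxE addr_gt0 // mulr_gt0.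
  have Pd : P *m (\sum_j g j *: S j) *m P^T = diag_mx d.
    rewrite !big_ord_recl big_ord0 addr0 mulmxDr mulmxDl -!scalemxAr -!scalemxAl.
    rewrite (_ : lift ord0 ord0 = 1) ?PS0 ?PS1; last exact/val_inj.
    by apply/matrixP => i j; rewrite !mxE; case: eqP => _; rewrite ?mulr1n ?mulr0n; ring.
  by rewrite (ln_det_congr Pu d0 Pd); congr (_ + _); apply: eq_bigr => i _; rewrite mxE.
pose N : R := (2 * n)%:R.
have N0 : 0 < N by rewrite ltr0n muln_gt0.
(* Replacing (g, Psi) by (c g, c Psi) does not change the objective, so [g 0] can be normalized to
   1. Here [N] is p n with p = 2. *)
pose g (j : 'I_2) : R := if j == 0 then 1 else t.
have g0 j : 0 < g j by rewrite /g; case: ifP.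
pose T h := \sum_j h j *: S j.
have pT h : (forall j, 0 < h j) -> is_posdef (T h) by move=> h0; exact: sum_posdef.
exists g, (N^-1 *: T g); split=> // [|g' Psi' g'0 pPsi'].
  by apply: posdef_scale; rewrite ?invr_gt0 //; exact: pT.
have [le' _] := trace_ln_det_min N0 (pT _ g'0) pPsi'.
have [_ eqg] := trace_ln_det_min N0 (pT _ g0) pPsi'.
rewrite /objective -!/(T _) -/N eqg.
apply: le_trans (lerB le' (lexx _)).
rewrite !lnT // !big_ord_recl !big_ord0 !addr0 (_ : lift ord0 ord0 = 1); last exact/val_inj.
have := tmin _ _ (g'0 0) (g'0 1).
rewrite !sumrB -!mulr_sumr !sumr_const !card_ord -!(mulr_natl (ln _)).
rewrite /g /= ln1 natrM /N natrM.
set A := \sum_i ln (1 + _); set B := \sum_i ln (_ + _ * _).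
(* Since N = 2 n, [n] times the inequality for [t] is the comparison of the objectives already
   minimized over [Psi], up to a common constant. *)
move=> /(ler_wpM2l (ler0n R n)); lra.
Qed.
End Existence.

(** * From the likelihood to the objective *)

Section MaximumLikelihood.
Context {R : realType}.

Lemma posdiagE p (Gamma : 'M[R]_p) : is_posdiag Gamma ->
  exists2 d : 'rV[R]_p, (forall i, 0 < d 0 i) & Gamma = diag_mx d.
Proof.
move=> [/diag_mxP[d ->] d0]; exists d => // i.
by have := d0 i; rewrite mxE eqxx.
Qed.

Lemma diag_mx_posdiag p (d : 'rV[R]_p) : (forall i, 0 < d 0 i) ->
  is_posdiag (diag_mx d).
Proof.
by move=> d0; split=> [|i]; [exact: diag_mx_is_diag|rewrite mxE eqxx mulr1n].
Qed.

Lemma invmx_diag p (d : 'rV[R]_p) : (forall i, 0 < d 0 i) ->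
  invmx (diag_mx d) = diag_mx (map_mx GRing.inv d).
Proof.
move=> d0; have [|-> _] := congr_diag (unitmx1 _ _) d0 (B := diag_mx d).
  by rewrite trmx1 mul1mx mulmx1.
by rewrite trmx1 mul1mx mulmx1.
Qed.

Lemma powR_expR_ln (a x : R) : 0 < a -> a `^ x = expR (x * ln a).
Proof. by move=> a0; rewrite /powR gt_eqF. Qed.

Lemma posdef_det_gt0 q (Psi : 'M[R]_q) : is_posdef Psi -> 0 < \det Psi.
Proof.
move=> pPsi; have [P [d [P1 PPsi]]] := simultaneous_diagonalization pPsi pPsi.1.
have Pu := congr_diag_unit P1; have d0 i := congr_diag_gt0 i Pu pPsi PPsi.
have [_ ->] := congr_diag Pu d0 PPsi.
by rewrite mulr_gt0 ?det_unit_sqr_gt0 // prodr_gt0.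
Qed.

Variables (p q n : nat) (X : 'I_n -> 'M[R]_(p, q)).

Definition scatter (i : 'I_p) : 'M[R]_q :=
  \sum_(k < n) (row i (X k - sample_mean X))^T *m row i (X k - sample_mean X).

Lemma quadratic_diag (Y : 'M[R]_(p, q)) (d : 'rV[R]_p) :
  Y^T *m diag_mx d *m Y = \sum_i d 0 i *: ((row i Y)^T *m row i Y).
Proof.
apply/matrixP => a b; rewrite mxE summxE; apply: eq_bigr => i _.
by rewrite mul_mx_diag !mxE big_ord1 !mxE; ring.
Qed.

(** The entries of Gamma^-1 weight the rows of the deviations; exchanging the sums over samples and
    rows makes the scatter matrices appear. *)
Lemma likelihood_objective Gamma Psi :
  is_posdiag Gamma -> is_posdef Psi ->
  likelihood X (sample_mean X) Gamma Psi =
  (2 * pi) `^ (- ((p * q * n)%:R / 2)) *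
  expR (- (objective n scatter (fun i => (Gamma i i)^-1) Psi / 2)).
Proof.
move=> /posdiagE[d d0 ->] pPsi; rewrite /likelihood invmx_diag //.
have -> : \sum_(k < n) (X k - sample_mean X)^T *m
      diag_mx (map_mx GRing.inv d) *m (X k - sample_mean X) =
    \sum_i (diag_mx d i i)^-1 *: scatter i.
  under eq_bigr do rewrite quadratic_diag.
  rewrite exchange_big; apply: eq_bigr => i _ /=.
  by rewrite -scaler_sumr !mxE eqxx mulr1n.
rewrite det_diag !powR_expR_ln ?posdef_det_gt0 ?prodr_gt0 ?mulr_gt0 ?pi_gt0 //.
rewrite -!expRD ln_prod //; congr expR.
rewrite /objective.
have -> : \sum_j ln (diag_mx d j j)^-1 = - \sum_j ln (d 0 j).
  by rewrite -sumrN; apply: eq_bigr => j _; rewrite mxE eqxx mulr1n lnV ?posrE.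
by field.
Qed.

Lemma sum_deviation : (0 < n)%N -> \sum_(k < n) (X k - sample_mean X) = 0.
Proof.
move=> n0; rewrite sumrB sumr_const card_ord /sample_mean -scaler_nat scalerA.
by rewrite divff ?scale1r ?subrr // pnatr_eq0 -lt0n.
Qed.

(** Expand around the sample mean, with E its difference from [M]: the cross terms vanish because
    the deviations sum to zero, and the extra term n tr(Psi^-1 E^T Gamma^-1 E) is nonnegative. *)
Lemma likelihood_le_mean (M : 'M[R]_(p, q)) Gamma Psi : (0 < n)%N ->
  is_posdiag Gamma -> is_posdef Psi ->
  likelihood X M Gamma Psi <= likelihood X (sample_mean X) Gamma Psi.
Proof.
move=> n0 pGamma pPsi.
rewrite ler_wpM2l ?mulr_ge0 ?powR_ge0 // ler_expR lerN2 ler_pM2r //.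
have [d d0 ->] := posdiagE pGamma; rewrite invmx_diag //.
set G := diag_mx _; set m := sample_mean X; pose E := m - M.
have -> : \sum_(k < n) (X k - M)^T *m G *m (X k - M) =
    \sum_(k < n) (X k - m)^T *m G *m (X k - m) + n%:R *: (E^T *m G *m E).
  have XE k : (X k - M)^T *m G *m (X k - M) =
      (X k - m)^T *m G *m (X k - m) + (X k - m)^T *m G *m E +
      (E^T *m G *m (X k - m) + E^T *m G *m E).
    have -> : X k - M = (X k - m) + E by rewrite /E addrA subrK.
    by rewrite -!mulmxDr -!mulmxDl -linearD.
  under eq_bigr do rewrite XE.
  rewrite !big_split /= -!mulmx_suml -!mulmx_sumr -linear_sum sum_deviation //=.
  rewrite trmx0 !mul0mx mulmx0 addr0 add0r sumr_const card_ord.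
  by rewrite -scaler_nat -!scalemxAl.
rewrite mulmxDr linearD /= lerDl -scalemxAr linearZ /= mulr_ge0 //.
have [P [e [P1 PPsi]]] := simultaneous_diagonalization pPsi pPsi.1.
have Pu := congr_diag_unit P1; have e0 i := congr_diag_gt0 i Pu pPsi PPsi.
rewrite (trace_congr_diag _ Pu e0 PPsi) sumr_ge0 // => i _.
rewrite divr_ge0 ?(ltW (e0 _)) // quadratic_diag mulmx_sumr mulmx_suml summxE.
apply: sumr_ge0 => j _; rewrite -scalemxAr -scalemxAl mxE mulr_ge0 //.
  by rewrite mxE invr_ge0 ltW.
have -> : P *m ((row j E)^T *m row j E) *m P^T =
    (row j E *m P^T)^T *m (row j E *m P^T).
  by rewrite trmx_mul trmxK !mulmxA.
by rewrite mxE big_ord1 mxE -expr2 sqr_ge0.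
Qed.

End MaximumLikelihood.

(** * Maximum likelihood estimators as minimizers, up to scaling *)

Section MleUnique.
Context {R : realType}.

(** With g = 1/d, a maximizer is compared with its competitors at the sample mean only; conversely,
    [likelihood_le_mean] reduces an arbitrary [M] to the sample mean. *)
Lemma is_mle_diag_minimizer p q n (X : 'I_n -> 'M[R]_(p, q)) K : (0 < n)%N ->
  is_mle_diag X K <->
  exists (d : 'rV[R]_p) Psi, K = Psi *t diag_mx d /\
    minimizes n (scatter X) (fun i => (d 0 i)^-1) Psi.
Proof.
move=> n0.
have mono g Psi g' Psi' : is_posdiag g -> is_posdiag g' ->
    is_posdef Psi -> is_posdef Psi' ->
    (likelihood X (sample_mean X) g Psi <= likelihood X (sample_mean X) g' Psi') =
    (objective n (scatter X) (fun i => (g' i i)^-1) Psi' <=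
     objective n (scatter X) (fun i => (g i i)^-1) Psi).
  move=> pg pg' pPsi pPsi'; rewrite !likelihood_objective //.
  by rewrite ler_pM2l ?powR_gt0 ?mulr_gt0 ?pi_gt0 // ler_expR lerN2 ler_pM2r.
have diagE (d : 'rV[R]_p) : (fun i => (diag_mx d i i)^-1) = (fun i => (d 0 i)^-1).
  by apply/funext => i; rewrite mxE eqxx mulr1n.
split.
  move=> [G [Psi [pG pPsi -> maxL]]].
  have [d d0 GE] := posdiagE pG; rewrite {}GE in pG maxL *.
  exists d, Psi; split=> //; split=> // [j|g' Psi' g'0 pPsi'].
    by rewrite invr_gt0.
  pose d' : 'rV[R]_p := \row_i (g' i)^-1.
  have d'0 i : 0 < d' 0 i by rewrite mxE invr_gt0.
  have := maxL (sample_mean X) _ _ (diag_mx_posdiag d'0) pPsi'.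
  rewrite mono ?diagE //; last exact: diag_mx_posdiag.
  by rewrite (_ : (fun i => (d' 0 i)^-1) = g') //; apply/funext => i; rewrite mxE invrK.
move=> [d [Psi [-> [d0 pPsi minPsi]]]].
have {}d0 i : 0 < d 0 i by have := d0 i; rewrite invr_gt0.
exists (diag_mx d), Psi; split=> // [|M G' Psi' pG' pPsi'].
  exact: diag_mx_posdiag.
apply: (le_trans (likelihood_le_mean X M n0 pG' pPsi')).
rewrite mono ?diagE //; last exact: diag_mx_posdiag.
apply: minPsi => // i; have [d' d'0 ->] := posdiagE pG'.
by rewrite mxE eqxx mulr1n invr_gt0.
Qed.

Lemma mle_diag_exists_unique q n (X : 'I_n -> 'M[R]_(2, q)) :
  (0 < q)%N -> (0 < n)%N -> (forall i, is_posdef (scatter X i)) ->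
  exists! K, is_mle_diag X K.
Proof.
move=> q0 n0 pS.
have [g [Psi [g0 pPsi minPsi]]] := minimizer_exists q0 n0 pS.
pose d : 'rV[R]_2 := \row_i (g i)^-1.
have gE : (fun i => (d 0 i)^-1) = g by apply/funext => i; rewrite mxE invrK.
exists (Psi *t diag_mx d); split.
  by apply/is_mle_diag_minimizer => //; exists d, Psi; split=> //; rewrite gE.
move=> K /is_mle_diag_minimizer[]// d' [Psi' [-> min']].
have := minimizer_unique (isT : 0 < 2)%N q0 pS _ min'.
have : minimizes n (scatter X) g Psi by [].
move=> min0 /(_ _ _ min0)[c [c0 d'E ->]].
apply/matrixP => i j; rewrite !mxE; case: eqP => _; last by rewrite !mulr0.
(* The factors scale oppositely: Psi' = c Psi while Gamma' = c^-1 Gamma, so [c] cancels in the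
   Kronecker product. *)
have -> : d' 0 (mxtens_unindex i).2 = c^-1 * (g (mxtens_unindex i).2)^-1.
  by rewrite -invfM -d'E invrK.
by rewrite !mulr1n; field; rewrite !gt_eqF.
Qed.

End MleUnique.

(** * Almost sure nondegeneracy *)

Section ProductNullSets.
Context {R : realType}.

(** Independence identifies the law of the pair with the product of the two laws; the measure of [E]
    is then the integral of the measures of its sections, all zero. *)
Lemma null_of_null_sections d d1 d2 (T : measurableType d)
    (T1 : measurableType d1) (T2 : measurableType d2) (P : probability T R)
    (f1 : {mfun T >-> T1}) (f2 : {mfun T >-> T2}) (E : set (T1 * T2)) :
  (forall A B, measurable A -> measurable B ->
    P (f1 @^-1` A `&` f2 @^-1` B) = (P (f1 @^-1` A) * P (f2 @^-1` B))%E) ->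
  measurable E -> (forall x, P (f2 @^-1` xsection E x) = 0%E) ->
  P.-negligible [set w | E (f1 w, f2 w)].
Proof.
move=> indep mE E0.
have mf : measurable_fun setT (fun w => (f1 w, f2 w)).
  by apply/measurable_fun_pairP; split; exact: measurable_funP.
have := mf measurableT E mE; rewrite setTI => mfE; apply/(negligibleP _ mfE); move: mfE => _.
pose f : {mfun T >-> (T1 * T2)%type} := mfun_Sub (mem_set mf).
rewrite -[LHS]/(distribution P f E).
rewrite -(product_measure_unique (m1 := distribution P f1)
  (m2 := distribution P f2) (m' := distribution P f) indep mE).
by apply: integral0_eq => x _ /=; exact: E0.
Qed.

(** The finite measures A -> P (A [&] C) and A -> P A * P C agree on a pi-system containing the
    whole space, hence on the sigma-algebra that it generates. *)
Lemma independent_sigma_algebra d (T : measurableType d) (P : probability T R)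
    (G : set (set T)) (C : set T) :
  setI_closed G -> G setT -> G `<=` measurable -> measurable C ->
  (forall A, G A -> P (A `&` C) = (P A * P C)%E) ->
  forall A, <<s G >> A -> P (A `&` C) = (P A * P C)%E.
Proof.
move=> GI GT Gm mC PG A sA.
have PC0 : 0 <= fine (P C) by rewrite fine_ge0 // measure_ge0.
have PCE : (fine (P C))%:E = P C by rewrite fineK // fin_num_measure.
have mscaleE B : mscale (NngNum PC0) P B = (P B * P C)%E.
  by rewrite /mscale /= PCE muleC.
rewrite -mscaleE -[LHS]/(mrestr P mC A).
apply: (g_sigma_algebra_measure_unique G Gm (fun=> setT)) => //.
- by rewrite bigcup_const //; exists 0%N.
- by move=> B GB; rewrite /= mscaleE; exact: PG.
- move=> k; rewrite /= /mrestr setTI.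
  exact: le_lt_trans (probability_le1 _ mC) (ltry _).
Qed.

Lemma measurable_det d (T : measurableType d) q (A : T -> 'M[R]_q) :
  (forall i j, measurable_fun setT (fun w => A w i j)) ->
  measurable_fun setT (fun w => \det (A w)).
Proof.
move=> mA; apply: measurable_sum => s.
apply: measurable_funM; first exact: measurable_cst.
by apply: measurable_prod => i _; exact: mA.
Qed.

Local Notation mtype p q :=
  (g_sigma_algebraType [set U : set 'M[R]_(p, q) | open U]).

Lemma measurable_entry p q (i : 'I_p) (j : 'I_q) :
  measurable_fun setT (fun Y : mtype p q => Y i j).
Proof.
apply: (measurability _ (RGenOpens.measurableE R)).
move=> _ [_ [a [b ->] <-]]; rewrite setTI; apply: sub_sigma_algebra.
apply: (open_comp _ (@interval_open _ (BRight a) (BLeft b) isT isT)).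
by move=> /= Y _; exact: coord_continuous.
Qed.

Lemma normal_law_set1 (m v c : R) : 0 < v -> normal_law m v [set c] = 0%E.
Proof.
move=> v0; rewrite /normal_law gt_eqF //.
have /null_content_dominatesP := @normal_prob_dominates R m (Num.sqrt v).
apply => //; exact: lebesgue_measure_set1.
Qed.
End ProductNullSets.

(** * Determinants of differences of Gaussian samples *)

Section GaussianSamples.
Context {R : realType} {d : measure_display} {T : measurableType d}.
Variable P : probability T R.

Local Notation mtype p q :=
  (g_sigma_algebraType [set U : set 'M[R]_(p, q) | open U]).

Lemma sum_mxtens_unindex m n (F : 'I_m -> 'I_n -> R) :
  \sum_(k < m * n) F (mxtens_unindex k).1 (mxtens_unindex k).2 =
  \sum_i \sum_j F i j.
Proof.
rewrite pair_big (reindex (@mxtens_unindex m n)) //=.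
by exists (@mxtens_index m n) => k _; rewrite ?mxtens_indexK ?mxtens_unindexK.
Qed.

(** The linear form is b^T vec(X), where [b] stacks the matrix with row [i] equal to [a] and zeros
    elsewhere. Its variance Gamma_ii (a Psi a^T) is positive, so its normal law has no atom. *)
Lemma gaussian_row_hyperplane p q (X : T -> 'M[R]_(p, q)) mu Gamma Psi
    (i : 'I_p) (a : 'rV[R]_q) (c : R) :
  is_posdiag Gamma -> is_posdef Psi ->
  multivariate_normal P (fun w => vec (X w)) mu (Psi *t Gamma) -> a != 0 ->
  P [set w | \sum_j a 0 j * X w i j = c] = 0%E.
Proof.
move=> [_ Gamma0] pPsi [_ normX] a0.
pose b : 'cV[R]_(q * p) := vec (\matrix_(l, j) (a 0 j *+ (l == i))).
have bE (Y : 'M[R]_(p, q)) : (b^T *m vec Y) 0 0 = \sum_j a 0 j * Y i j.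
  rewrite mxE; under eq_bigr do rewrite !mxE.
  rewrite (sum_mxtens_unindex (fun j l => (a 0 j *+ (l == i)) * Y l j)).
  apply: eq_bigr => j _; rewrite (bigD1 i) //= eqxx mulr1n big1 ?addr0 // => l.
  by move=> /negPf ->; rewrite mulr0n mul0r.
have Kb : (Psi *t Gamma) *m b =
    vec (\matrix_(l, j) (Gamma l i * \sum_m Psi j m * a 0 m)).
  apply/colP => k; rewrite !mxE; under eq_bigr do rewrite !mxE.
  rewrite (sum_mxtens_unindex (fun m l => Psi (mxtens_unindex k).1 m *
    Gamma (mxtens_unindex k).2 l * (a 0 m *+ (l == i)))) mulr_sumr.
  apply: eq_bigr => m _; rewrite (bigD1 i) //= eqxx mulr1n big1 ?addr0 => [|l].
    by ring.
  by move=> /negPf ->; rewrite mulr0n mulr0.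
have var0 : 0 < (b^T *m (Psi *t Gamma) *m b) 0 0.
  rewrite -mulmxA Kb bE.
  suff -> : \sum_j a 0 j * (\matrix_(l, j) (Gamma l i * \sum_m Psi j m * a 0 m)) i j =
      Gamma i i * (a *m Psi *m a^T) 0 0 by rewrite mulr_gt0 // posdef_row.
  rewrite -mulmxA mxE mulr_sumr; apply: eq_bigr => j _; rewrite !mxE.
  rewrite mulrCA; congr (_ * (_ * _)).
  by apply: eq_bigr => m _; rewrite mxE.
have := normX b [set c] (measurable_set1 c).
rewrite (normal_law_set1 _ _ var0) => <-; congr (P _).
by apply/seteqP; split=> w /=; rewrite bE.
Qed.

Variables (p q n : nat) (X : 'I_n.+1 -> T -> 'M[R]_(p, q)) (hqn : (q <= n)%N).
Hypothesis hXmeas : forall k, is_random_matrix (X k).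
Hypothesis hXindep : independent_matrices P X.

(** Row [r] uses sample [r + 1]; sample 0 is the common reference, which is why [q] differences need
    more than [q] samples. *)
Let s (r : 'I_q) : 'I_n.+1 := lift ord0 (widen_ord hqn r).

(* The rows [r >= k] are unit vectors, so that in the expansion along row [k] of
   the determinant of step [k + 1], the [k]-th coordinate of the sample X_(k+1)
   is multiplied by the determinant of step [k]. *)
Definition difference_mx (i : 'I_p) (k : nat) (w : T) : 'M[R]_q :=
  \matrix_(r, c) if (r < k)%N then X (s r) w i c - X ord0 w i c else (r == c)%:R.

(* Pi-system generating the sigma-algebra of the [X_j] with [j < m]. *)
Definition past (m : nat) : set (set T) :=
  [set A | exists2 B : 'I_n.+1 -> set 'M[R]_(p, q), (forall j, borel_matrix (B j)) &
    A = [set w | forall j : 'I_n.+1, (j < m)%N -> B j (X j w)]].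

Lemma random_matrix_measurable k : measurable_fun setT (X k : T -> mtype p q).
Proof. by move=> _ B mB; rewrite setTI; exact: hXmeas. Qed.

Lemma past_setT m : past m setT.
Proof.
exists (fun=> setT); first by move=> j; exact: (@measurableT _ (mtype p q)).
by apply/seteqP; split.
Qed.

Lemma past_setI m : setI_closed (past m).
Proof.
move=> _ _ [B mB ->] [C mC ->]; exists (fun j => B j `&` C j).
  by move=> j; apply: (@measurableI _ (mtype p q)); [exact: mB|exact: mC].
by apply/seteqP; split=> w /= => [[Bw Cw] j jm|BC];
  [split; [exact: Bw|exact: Cw]|split=> j /BC[]].
Qed.

Lemma past_measurable m : past m `<=` measurable.
Proof.
move=> _ [B mB ->].
apply: (@fin_bigcap_measurable _ _ _ [set j : 'I_n.+1 | (j < m)%N]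
  (fun j => X j @^-1` B j)); first exact: finite_finset.
by move=> j _; exact: hXmeas.
Qed.

(** Apply independence to the indices below [k], then to those up to [k] with [B] as the set at [k]:
    the two products differ by the single factor of index [k]. *)
Lemma past_independent (k : 'I_n.+1) A B : borel_matrix B -> past k A ->
  P (A `&` X k @^-1` B) = (P A * P (X k @^-1` B))%E.
Proof.
move=> mB [C mC ->].
have := hXindep [set j : 'I_n.+1 | (j < k)%N]%SET mC.
rewrite (_ : [set w | _] = [set w | forall j : 'I_n.+1, (j < k)%N -> C j (X j w)]);
  last first.
  by apply/seteqP; split=> w /= H j; have := H j; rewrite inE.
move=> ->.
pose C' j := if j == k then B else C j.
have mC' j : borel_matrix (C' j) by rewrite /C'; case: ifP.
have := hXindep [set j : 'I_n.+1 | (j <= k)%N]%SET mC'.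
rewrite (_ : [set w | _] = [set w | forall j : 'I_n.+1, (j < k)%N -> C j (X j w)]
   `&` X k @^-1` B); last first.
  apply/seteqP; split=> w /= => [H|[H Bk] j].
    split=> [j jk|]; last by have := H k; rewrite inE leqnn /C' eqxx; exact.
    by have := H j; rewrite inE ltnW // /C' lt_eqF //; exact.
  rewrite inE /C'; case: eqVneq => [->//|jk kj]; apply: H.
  by rewrite ltn_neqAle jk.
move=> ->; rewrite (bigD1 k) ?inE //= muleC; congr (_ * _)%E; last first.
  by rewrite /C' eqxx.
apply: eq_big => [j|j]; first by rewrite !inE ltn_neqAle andbC.
by move=> /andP[_ /negPf jk]; rewrite /C' jk.
Qed.

Lemma past_measurable_fun (m : nat) (j : 'I_n.+1) : (j < m)%N ->
  measurable_fun setT (X j : g_sigma_algebraType (past m) -> mtype p q).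
Proof.
move=> jm _ B mB; rewrite setTI; apply: sub_sigma_algebra.
exists (fun l => if l == j then B else setT).
  by move=> l; case: ifP => // _; exact: (@measurableT _ (mtype p q)).
apply/seteqP; split=> w /= => [Bw l _|H]; first by case: eqVneq => // ->.
by have := H j jm; rewrite eqxx.
Qed.

(** The first [k] rows involve the samples 0, ..., k, hence the past of index [k.+1]. *)
Lemma past_difference_mx i (k : nat) (r c : 'I_q) :
  measurable_fun setT (fun w : g_sigma_algebraType (past k.+1) =>
    difference_mx i k w r c).
Proof.
under eq_fun do rewrite mxE.
have [rk|_] := boolP (r < k)%N; last exact: measurable_cst.
apply: measurable_funB; apply: (measurableT_comp (measurable_entry i c));
  exact: past_measurable_fun.
Qed.

Lemma past_cofactor_difference_mx i (k : nat) (r c : 'I_q) :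
  measurable_fun setT (fun w : g_sigma_algebraType (past k.+1) =>
    cofactor (difference_mx i k w) r c).
Proof.
apply: measurable_funM; first exact: measurable_cst.
apply: measurable_det => a b.
by under eq_fun do rewrite mxE mxE; exact: past_difference_mx.
Qed.

(** Steps [k] and [k.+1] differ in row [k] only, and the cofactor deletes that row. *)
Lemma cofactor_difference_mx i w (k c : 'I_q) :
  cofactor (difference_mx i k.+1 w) k c = cofactor (difference_mx i k w) k c.
Proof.
congr (_ * \det _); apply/matrixP => a b; rewrite !mxE ltnS leq_eqVlt.
by have := neq_lift k a; rewrite -val_eqE eq_sym => /negPf /= ->.
Qed.

Lemma det_difference_mx i w (k : 'I_q) :
  \det (difference_mx i k w) = cofactor (difference_mx i k w) k k.
Proof.
rewrite (expand_det_row _ k) (bigD1 k) //= mxE ltnn eqxx mul1r big1 ?addr0 // => c ck.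
by rewrite mxE ltnn eq_sym (negPf ck) mul0r.
Qed.

Lemma det_difference_mxS i w (k : 'I_q) :
  \det (difference_mx i k.+1 w) =
  \sum_c (X (s k) w i c - X ord0 w i c) * cofactor (difference_mx i k w) k c.
Proof.
rewrite (expand_det_row _ k); apply: eq_bigr => c _.
by rewrite cofactor_difference_mx mxE ltnSn.
Qed.

Variables (mu : 'cV[R]_(q * p)) (Gamma : 'M[R]_p) (Psi : 'M[R]_q).
Hypotheses (hGamma : is_posdiag Gamma) (hPsi : is_posdef Psi).
Hypothesis hXnormal : forall k,
  multivariate_normal P (fun w => vec (X k w)) mu (Psi *t Gamma).

(** Given samples 0, ..., k with nonzero determinant at step [k], the next determinant is a
    nonconstant affine function of row [i] of sample k + 1, which is independent of them. Its zeros
    form a hyperplane, hence a null set. *)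
Lemma negligible_det_difference_mxS i (k : 'I_q) :
  P.-negligible [set w | \det (difference_mx i k w) = 0] ->
  P.-negligible [set w | \det (difference_mx i k.+1 w) = 0].
Proof.
move=> IHk.
pose T1 := g_sigma_algebraType (past (s k)).
pose a (w : T1) c := cofactor (difference_mx i k w) k c.
pose E : set (T1 * mtype p q) := [set wy : T1 * mtype p q | \det (difference_mx i k wy.1) != 0 /\
  \sum_c (wy.2 i c - X ord0 wy.1 i c) * a wy.1 c = 0].
(* The identity into the coarser sigma-algebra of the past serves as the random variable carrying
   all earlier samples. *)
have mid : measurable_fun setT (id : T -> T1).
  move=> _ A mA; rewrite setTI preimage_id.
  exact: (smallest_sub (@sigma_algebra_measurable _ T) (@past_measurable (s k))).
pose f1 : {mfun T >-> T1} := mfun_Sub (mem_set mid).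
pose f2 : {mfun T >-> mtype p q} := mfun_Sub (mem_set (random_matrix_measurable (s k))).
have E0 : P.-negligible [set w | E (f1 w, f2 w)].
  apply: null_of_null_sections.
  - move=> A B mA mB; rewrite [f1 @^-1` A]preimage_id.
    apply: (independent_sigma_algebra (past_setI (m := s k)) (past_setT _) _ _ _ mA).
    + exact: past_measurable.
    + exact: hXmeas.
    + by move=> A' pA'; exact: past_independent.
  - have mdet1 : measurable_fun setT (fun w : T1 => \det (difference_mx i k w)).
      by apply: measurable_det => r c; exact: past_difference_mx.
    have mdet := measurableT_comp mdet1 (@measurable_fst _ _ T1 (mtype p q)).
    have mX0 : measurable_fun setT (X ord0 : T1 -> mtype p q).
      exact: past_measurable_fun.
    have mlin : measurable_fun setT (fun wy : T1 * mtype p q =>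
        \sum_c (wy.2 i c - X ord0 wy.1 i c) * a wy.1 c).
      apply: measurable_sum => c; apply: measurable_funM; last first.
        exact: (measurableT_comp (@past_cofactor_difference_mx i k k c) measurable_fst).
      apply: measurable_funB.
        exact: (measurableT_comp (measurable_entry i c) measurable_snd).
      apply: (measurableT_comp (measurable_entry i c)).
      exact: (measurableT_comp mX0 measurable_fst).
    rewrite (_ : E = (setT `&` (fun wy : T1 * mtype p q =>
        \det (difference_mx i k wy.1)) @^-1` (~` [set 0])) `&`
      (setT `&` (fun wy : T1 * mtype p q =>
        \sum_c (wy.2 i c - X ord0 wy.1 i c) * a wy.1 c) @^-1` [set 0])).
      apply: measurableI; [apply: mdet => //|apply: mlin => //].
      exact: measurableC.
    by apply/seteqP; split=> wy; rewrite !setTI /E /= => -[/eqP ? ?]; split=> //; apply/eqP.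
  - move=> w; have [D0|D0] := eqVneq (\det (difference_mx i k w)) 0.
      rewrite (_ : xsection E w = set0) ?preimage_set0 ?measure0 //.
      by apply/seteqP; split=> // y; rewrite /xsection /= inE => -[/= /eqP].
    (* The normal vector of the hyperplane; its coordinate [k] is the determinant of step [k], so it
       is nonzero. *)
    pose b : 'rV[R]_q := \row_c a w c.
    have b0 : b != 0.
      apply: contra_neq D0 => b0; rewrite det_difference_mx.
      by have := congr1 (fun v : 'rV_q => v 0 k) b0; rewrite !mxE.
    rewrite -(gaussian_row_hyperplane i (\sum_c X ord0 w i c * a w c) hGamma hPsi
      (hXnormal (s k)) b0); congr (P _).
    have eqE y : (\sum_c (y i c - X ord0 w i c) * a w c = 0) <->
        (\sum_c b 0 c * y i c = \sum_c X ord0 w i c * a w c) :> Prop.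
      under eq_bigr do rewrite mulrBl mulrC; rewrite sumrB.
      under [in X in _ <-> X]eq_bigr do rewrite mxE.
      by split=> [/eqP|->]; rewrite ?subrr // subr_eq0 => /eqP.
    apply/seteqP; split=> w' /=; rewrite /xsection /= inE /E /= => H.
      by apply/eqE; case: H.
    by split=> //; apply/eqE.
apply: (negligibleS _ (negligibleU IHk E0)).
  move=> w /=; rewrite det_difference_mxS => D1.
  by have [?|D0] := eqVneq (\det (difference_mx i k w)) 0; [left|right].
Qed.

Lemma negligible_det_difference_mx i k : (k <= q)%N ->
  P.-negligible [set w | \det (difference_mx i k w) = 0].
Proof.
elim: k => [_|k IHk kq].
  rewrite (_ : [set w | _] = set0); first exact: negligible_set0.
  apply/seteqP; split=> // w /=.
  rewrite (_ : difference_mx i 0 w = 1%:M) ?det1; last by apply/matrixP => r c; rewrite !mxE.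
  by move/eqP; rewrite oner_eq0.
exact: (@negligible_det_difference_mxS i (Ordinal kq) (IHk (ltnW kq))).
Qed.
End GaussianSamples.

(** * Positive definiteness of the scatter matrices *)

Section ScatterPositive.
Context {R : realType}.

(** The quadratic form at [v] is a sum of squares. If it vanishes, [v] is killed by row [i] of every
    deviation from the mean, hence of every difference with sample 0, as the mean cancels. *)
Lemma scatter_posdef p q n (Y : 'I_n.+1 -> 'M[R]_(p, q)) (i : 'I_p) :
  (forall v : 'cV[R]_q, (forall k, row i (Y k - Y ord0) *m v = 0) -> v = 0) ->
  is_posdef (scatter Y i).
Proof.
move=> Yfree; split=> [|v v0].
  by rewrite linear_sum; apply: eq_bigr => k _; rewrite /= trmx_mul trmxK.
pose z k := (row i (Y k - sample_mean Y) *m v) 0 0.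
have -> : (v^T *m scatter Y i *m v) 0 0 = \sum_k z k ^+ 2.
  rewrite mulmx_sumr mulmx_suml summxE; apply: eq_bigr => k _.
  by rewrite mulmxA -trmx_mul -mulmxA mxE big_ord1 mxE.
rewrite lt_neqAle sumr_ge0 ?andbT => [|k _]; last exact: sqr_ge0.
apply: contra_neq v0 => /esym/eqP; rewrite psumr_eq0 => [|k _]; last exact: sqr_ge0.
move=> /allP z0; apply: Yfree => k.
have {}z0 l : row i (Y l - sample_mean Y) *m v = 0.
  apply/matrixP => a b; rewrite !ord1 [RHS]mxE; apply/eqP.
  by rewrite -sqrf_eq0; apply: (z0 l); rewrite mem_index_enum.
have -> : Y k - Y ord0 = (Y k - sample_mean Y) - (Y ord0 - sample_mean Y).
  by rewrite opprB addrA subrK.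
by rewrite linearB mulmxBl /= !z0 subrr.
Qed.

End ScatterPositive.

Theorem theorem9 (R : realType) (d : measure_display) (T : measurableType d)
    (P : probability T R) (p q n : nat)
    (hp : (0 < p)%N) (hq : (0 < q)%N) (hn : (0 < n)%N)
    (mu : 'cV[R]_(q * p)) (Gamma : 'M[R]_p) (Psi : 'M[R]_q)
    (hGamma : is_posdiag Gamma) (hPsi : is_posdef Psi)
    (X : 'I_n -> T -> 'M[R]_(p, q))
    (hXmeas : forall k, is_random_matrix (X k))
    (hXindep : independent_matrices P X)
    (hXnormal : forall k,
      multivariate_normal P (fun w => vec (X k w)) mu (Psi *t Gamma))
    (hnq : (q < n)%N) (hp2 : p = 2%N) :
  {ae P, forall w, exists! K : 'M[R]_(q * p), is_mle_diag (fun k => X k w) K}.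
Proof.
subst p; case: n hn hnq X hXmeas hXindep hXnormal => // n hn hnq X mX iX nX.
have hqn : (q <= n)%N := hnq.
have N i := negligible_det_difference_mx hqn mX iX hGamma hPsi nX i (leqnn q).
(* The exceptional event is the union, over the two rows, of the vanishing of the full difference
   determinant. *)
apply: (negligibleS _ (negligibleU (N 0) (N 1))) => w /= notuniq.
apply: contrapT => /not_orP[D0 D1]; apply: notuniq.
apply: mle_diag_exists_unique => // i; apply: scatter_posdef => v Yv.
have /eqP Du : \det (difference_mx X hqn i q w) <> 0.
  by case: i {Yv} => -[|[|//]] i; [rewrite (_ : Ordinal i = 0)|rewrite (_ : Ordinal i = 1)];
    rewrite //; exact/val_inj.
have {}Du : difference_mx X hqn i q w \in unitmx by rewrite unitmxE unitfE.
(* At step [q] every row is a genuine difference, so [Yv] says that this invertible matrix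
   annihilates [v]. *)
apply: (can_inj (mulKmx Du)); rewrite mulmx0; apply/row_matrixP => r.
rewrite row_mul row0 -[RHS](Yv (lift ord0 (widen_ord hqn r))); congr (_ *m _).
by apply/rowP => c; rewrite !mxE ltn_ord.
Qed.
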